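(* Let $n \geq 3$ and $m \geq 1$ be integers, let $\lambda_0 \geq 0 > \lambda_1 \geq \lambda_2 \geq \cdots \geq \lambda_n$ be real numbers, and let $z_1, \ldots, z_m$ be complex numbers with $z_j = a_j + b_j i$, where $a_j \in \mathbb{R}$ and $b_j > 0$ for $j = 1, \ldots, m$. If $$\lambda_0 + \sum_{j=1}^n \lambda_j - 2\sum_{j=1}^m |z_j| \geq 0,$$ then there is an $(n+2m+1) \times (n+2m+1)$ normal centrosymmetric nonnegative matrix whose eigenvalues are $\lambda_0, \lambda_1, \ldots, \lambda_n, z_1, \ldots, z_m, \overline{z}_1, \ldots, \overline{z}_m$.
   Context: A real square matrix is nonnegative if all its entries are nonnegative. For each size $k$, $J$ denotes the $k \times k$ reverse identity matrix (ones on the anti-diagonal, zeros elsewhere). A $k \times k$ matrix $A$ is centrosymmetric if $JAJ = A$. A matrix $A$ is normal if $AA^* = A^*A$. *)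

(* Defs.v *)
From HB Require Import structures.
From mathcomp Require Import all_boot all_order all_algebra.
From mathcomp Require Import reals complex.
Set Implicit Arguments. Unset Strict Implicit. Unset Printing Implicit Defensive.
Import Order.TTheory GRing.Theory Num.Theory.
Local Open Scope ring_scope.

Definition revId (R : pzRingType) (k : nat) : 'M[R]_k :=
  \matrix_(i < k, j < k) ((i + j == k.-1)%N)%:R.

Definition centrosymmetric (R : pzRingType) (k : nat) (A : 'M[R]_k) : Prop :=
  revId R k *m A *m revId R k = A.

Definition nonneg_mx (R : numDomainType) (k : nat) (A : 'M[R]_k) : Prop :=
  forall i j, 0 <= A i j.

Definition normal_real_mx (R : pzRingType) (k : nat) (A : 'M[R]_k) : Prop :=
  A *m A^T = A^T *m A.

(* The eigenvalues (with multiplicity) of the real matrix A, viewed as a complex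
   matrix, are the entries of the list s: its characteristic polynomial over
   R[i] splits as prod (X - s_i). *)
Definition real_mx_eigenvalues (R : realType) (k : nat) (A : 'M[R]_k)
    (s : seq R[i]) : Prop :=
  char_poly (map_mx (fun x : R => (x%:C)%C) A) = \prod_(c <- s) ('X - c%:P).

(* Main.v *)
(** A centrosymmetric matrix of size 2k + e, with e <= 1, is orthogonally similar to P (+) Q,
    where P of size k + e and Q of size k act on the symmetric and the antisymmetric
    vectors; it is nonnegative as soon as P is nonnegative and |Q| is dominated by the
    upper left k x k block of P.

    If P has spectrum s with a nonnegative unit eigenvector for its Perron root alpha,
    bordering P by a multiple of that eigenvector and a diagonal entry beta replaces alpha
    by any two numbers la > mu with la + mu = alpha + beta and la >= alpha, beta.  Bordering
    with beta = - lambda_j while adding lambda_j to Q as a direct summand consumes two of the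
    negative eigenvalues; bordering with beta = 0 at the centre consumes one.  This leaves the
    case of a single negative eigenvalue, n = 1.

    For n = 1 take P and Q of size r = m + 1 diagonalised by Fourier vectors (x^i), with x
    ranging over the roots of x^r = 1 for P and of x^r = 1 or x^r = -1 for Q; the z_j are
    shared evenly between P and Q.  All vectors have entries of modulus 1, so the entries of
    P and Q are controlled by sums of the moduli of the eigenvalues.  The sign is -1 exactly
    when r is even: then P takes both real eigenvalues and Q, having no real Fourier vector,
    takes only conjugate pairs. *)
Require Import Defs.
From HB Require Import structures.
From mathcomp Require Import all_boot all_order all_algebra.
From mathcomp Require Import reals complex.
From mathcomp Require Import separable.
From mathcomp Require Import zify ring lra.
Set Implicit Arguments.
Unset Strict Implicit.
Unset Printing Implicit Defensive.
Import Order.TTheory GRing.Theory Num.Theory.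
Local Open Scope ring_scope.

(** * Entrywise nonnegative matrices and the block form of the reverse identity *)

Lemma nonneg_mulmx (R : numDomainType) (m n p : nat) (A : 'M[R]_(m, n)) (B : 'M[R]_(n, p)) :
  (forall i j, 0 <= A i j) -> (forall i j, 0 <= B i j) ->
  forall i j, 0 <= (A *m B) i j.
Proof. by move=> A0 B0 i j; rewrite mxE sumr_ge0 // => l _; rewrite mulr_ge0. Qed.

Lemma nonneg_scalemx (R : numDomainType) (m n : nat) (c : R) (A : 'M[R]_(m, n)) :
  0 <= c -> (forall i j, 0 <= A i j) -> forall i j, 0 <= (c *: A) i j.
Proof. by move=> c0 A0 i j; rewrite mxE mulr_ge0. Qed.

Lemma nonneg_row_mx (R : numDomainType) (m n1 n2 : nat)
    (A : 'M[R]_(m, n1)) (B : 'M[R]_(m, n2)) :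
  (forall i j, 0 <= A i j) -> (forall i j, 0 <= B i j) ->
  forall i j, 0 <= row_mx A B i j.
Proof. by move=> A0 B0 i j; rewrite mxE; case: (split j). Qed.

Lemma nonneg_col_mx (R : numDomainType) (m1 m2 n : nat)
    (A : 'M[R]_(m1, n)) (B : 'M[R]_(m2, n)) :
  (forall i j, 0 <= A i j) -> (forall i j, 0 <= B i j) ->
  forall i j, 0 <= col_mx A B i j.
Proof. by move=> A0 B0 i j; rewrite mxE; case: (split i). Qed.

Lemma revId_ge0 (R : numDomainType) (k : nat) (i j : 'I_k) : 0 <= revId R k i j.
Proof. by rewrite mxE ler0n. Qed.

Lemma revId_tr (R : pzRingType) (k : nat) : (revId R k)^T = revId R k.
Proof. by apply/matrixP=> i j; rewrite !mxE addnC. Qed.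

Lemma revId_invol (R : pzRingType) (k : nat) : revId R k *m revId R k = 1%:M.
Proof.
apply/matrixP=> i j; rewrite !mxE (bigD1 (rev_ord i)) //= !mxE big1 ?addr0.
  have -> : (i + rev_ord i == k.-1)%N by apply/eqP; case: i => i /=; lia.
  rewrite mul1r; congr (_%:R); rewrite -val_eqE /=; apply/eqP/eqP; case: i j => i ? [j ?] /=; lia.
move=> l nl; rewrite !mxE; case: eqP => [e|_]; last by rewrite mul0r.
case/eqP: nl; apply: val_inj; case: i l e => i ? [l ?] /=; lia.
Qed.

(** For [e <= 1] the reverse identity of size [e] is the identity, whence the central [1%:M].
    Indices are split as [(k + e) + k] to match the sizes of [P] and [Q]. *)
Lemma revId_block (R : pzRingType) (k e : nat) : (e <= 1)%N ->
  revId R (k + e + k) =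
    block_mx (block_mx 0 0 0 1%:M) (col_mx (revId R k) 0) (row_mx (revId R k) 0) 0.
Proof.
move=> e1; apply/matrixP=> i j; rewrite !mxE /=.
case: splitP => i' /= ->; rewrite !mxE.
- case: splitP => j' /= ->; rewrite !mxE; case: splitP => i2 /= ->; rewrite !mxE //.
  + case: splitP => j2 /= ->; rewrite !mxE //; case: i2 j2 => i2 ? [j2 ?] /=; case: eqP => //; lia.
  + case: splitP => j2 /= ->; rewrite !mxE //; case: i2 j2 => i2 ? [j2 ?] /=.
      by case: eqP => //; lia.
    by rewrite -val_eqE /=; congr (_%:R); apply/eqP/eqP; lia.
  + by congr (_%:R); case: i2 j' => i2 ? [j2 ?] /=; apply/eqP/eqP; lia.
  + by case: i2 j' => i2 ? [j2 ?] /=; case: eqP => //; lia.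
- case: splitP => j' /= ->; rewrite !mxE.
  + case: splitP => j2 /= ->; rewrite !mxE; case: i' j2 => i2 ? [j2 ?] /=.
      by congr (_%:R); apply/eqP/eqP; lia.
    by case: eqP => //; lia.
  + by case: i' j' => i2 ? [j2 ?] /=; case: eqP => //; lia.
Qed.

(** * Characteristic polynomials and the assembly of [P] and [Q] into one matrix *)

Lemma char_poly_conj (R : comNzRingType) (k : nat) (E F D : 'M[R]_k) :
  E *m F = 1%:M -> char_poly (E *m D *m F) = char_poly D.
Proof.
move=> EF; rewrite /char_poly /char_poly_mx.
set f := map_mx polyC.
have fM (A B : 'M[R]_k) : f (A *m B) = f A *m f B by exact: map_mxM.
have EF' : f E *m f F = 1%:M by rewrite -fM EF /f map_mx1.
have -> : 'X%:M - f (E *m D *m F) = f E *m ('X%:M - f D) *m f F.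
  by rewrite !fM mulmxBr mulmxBl scalar_mxC -(mulmxA 'X%:M) EF' mulmx1.
by rewrite !det_mulmx mulrAC -det_mulmx EF' det1 mul1r.
Qed.

Lemma char_poly_block_diag (R : comNzRingType) (k l : nat) (P : 'M[R]_k) (Q : 'M[R]_l) :
  char_poly (block_mx P 0 0 Q) = char_poly P * char_poly Q.
Proof.
rewrite /char_poly /char_poly_mx map_block_mx !map_mx0 scalar_mx_block.
by rewrite opp_block_mx add_block_mx !oppr0 !addr0 det_ublock.
Qed.

(** The witness is [E *m D *m E^T] with [E] orthogonal and [D] the direct sum of [P] and [Q], so
    normality and the spectrum are inherited from the summands. *)
Lemma assemble (R : rcfType) (k e : nat) (P : 'M[R]_(k + e)) (Q : 'M[R]_k) :
  (e <= 1)%N -> normal_real_mx P -> normal_real_mx Q -> nonneg_mx P ->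
  (forall i j, `|Q i j| <= ulsubmx P i j) ->
  exists A : 'M[R]_(k + e + k),
    [/\ normal_real_mx A, centrosymmetric A, nonneg_mx A
      & char_poly A = char_poly P * char_poly Q].
Proof.
move=> e1 nP nQ P0 QP.
set J := revId R k; pose c : R := Num.sqrt 2%:R^-1.
have cc : c * c = 2%:R^-1 by rewrite -expr2 sqr_sqrtr // invr_ge0 ler0n.
have c0 : 0 <= c by rewrite sqrtr_ge0.
(* With [c] equal to 1/sqrt 2, the columns are the symmetric vectors c(x, 0, Jx), the central unit
   vector if [e = 1], and the antisymmetric vectors c(x, 0, -Jx). *)
pose E : 'M[R]_(k + e + k) :=
  block_mx (block_mx c%:M 0 0 1%:M) (col_mx c%:M 0) (row_mx (c *: J) 0) (- (c *: J)).
(* The eigenvalues of the reverse identity on the columns of [E]. As [S] commutes with [D] and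
   squares to 1, the conjugate of [D] by [E] is centrosymmetric. *)
pose S : 'M[R]_(k + e + k) := block_mx 1%:M 0 0 (- 1%:M).
pose D := block_mx P 0 0 Q.
have JJ : J *m J = 1%:M := revId_invol R k.
have JT : J^T = J := revId_tr R k.
have ET : E^T = block_mx (block_mx c%:M 0 0 1%:M) (col_mx (c *: J) 0) (row_mx c%:M 0) (- (c *: J)).
  rewrite /E tr_block_mx tr_block_mx tr_col_mx tr_row_mx !trmx0 !tr_scalar_mx.
  have cJT : (c *: J)^T = c *: J by rewrite linearZ /= JT.
  by rewrite [(- _)^T]raddfN /= cJT.
have EE : E *m E^T = 1%:M.
  rewrite ET /E !mulmx_block mul_col_row mul_row_block mul_block_col.
  rewrite mul_row_col mul_col_mx mul_mx_row.
  rewrite !(mulmx0,mul0mx,mulmx1,mul1mx,mulmxN,mulNmx,addr0,add0r,oppr0,opprK).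
  rewrite -!scalar_mxM cc mul_scalar_mx mul_mx_scalar -scalemxAl -scalemxAr JJ !scalerA cc.
  rewrite !add_block_mx add_col_mx add_row_mx !subrr !addr0 col_mx0 row_mx0.
  have hh : 2%:R^-1 + 2%:R^-1 = 1 :> R by lra.
  by rewrite -scalemx1 -!scalerDl hh !scale1r -!scalar_mx_block.
have EE' : E^T *m E = 1%:M by exact: mulmx1C EE.
have nD : D *m D^T = D^T *m D.
  by rewrite /D tr_block_mx !trmx0 !mulmx_block !mulmx0 !mul0mx !addr0 !add0r nP nQ.
have DT : (E *m D *m E^T)^T = E *m D^T *m E^T by rewrite !trmx_mul trmxK mulmxA.
have JE : revId R (k + e + k) *m E = E *m S.
  rewrite revId_block // /E /S !mulmx_block.
  rewrite !(mulmx0,mul0mx,mulmx1,mul1mx,mulmxN,mulNmx,addr0,add0r,oppr0,opprK).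
  rewrite mul_block_col mul_row_block mul_col_row mul_row_col mul_col_mx.
  rewrite !(mulmx0,mul0mx,mulmx1,mul1mx,mulmxN,mulNmx,addr0,add0r,oppr0,opprK).
  rewrite -!scalemxAr JJ scalemx1 mul_mx_scalar.
  by rewrite add_block_mx opp_col_mx !addr0 !add0r col_mx0 ?opp_col_mx ?oppr0 add0r.
have ST : S^T = S by rewrite /S tr_block_mx !trmx0 [(- _)^T]raddfN /= !trmx1.
have EJ : E^T *m revId R (k + e + k) = S *m E^T.
  by rewrite -[revId _ _]revId_tr -trmx_mul JE trmx_mul ST.
exists (E *m D *m E^T); split.
- rewrite /normal_real_mx DT !mulmxA.
  by rewrite -!(mulmxA _ E^T E) EE' !mulmx1 -!(mulmxA E) nD.
- rewrite /centrosymmetric !mulmxA JE -!(mulmxA _ E^T) EJ -!mulmxA.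
  congr (E *m _); rewrite !mulmxA; congr (_ *m _).
  by rewrite /S /D !mulmx_block !(mulmx0,mul0mx,mulmx1,mul1mx,mulmxN,mulNmx,addr0,add0r,oppr0,opprK).
- set P1 := ulsubmx P; set P2 := ursubmx P; set P3 := dlsubmx P; set P4 := drsubmx P.
  (* [Q] enters only through [P1 + Q] and [P1 - Q], which are nonnegative by domination; every other
     block is a block of [P], possibly scaled or reversed. *)
  have -> : E *m D *m E^T =
     block_mx (block_mx (2%:R^-1 *: (P1 + Q)) (c *: P2) (c *: P3) P4)
              (col_mx (2%:R^-1 *: ((P1 - Q) *m J)) (c *: (P3 *m J)))
              (row_mx (2%:R^-1 *: (J *m (P1 - Q))) (c *: (J *m P2)))
              (2%:R^-1 *: (J *m (P1 + Q) *m J)).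
    rewrite ET /E /D -[in LHS](submxK P) -/P1 -/P2 -/P3 -/P4.
    rewrite !mulmx_block.
    rewrite !(mulmx0,mul0mx,mulmx1,mul1mx,mulmxN,mulNmx,addr0,add0r,oppr0,opprK).
    rewrite mulmx_block !mul_col_mx mul_row_block.
    rewrite !(mulmx0,mul0mx,mulmx1,mul1mx,mulmxN,mulNmx,addr0,add0r,oppr0,opprK).
    rewrite mul_row_block mul_mx_row mul_mx_row !mul_row_col.
    rewrite !(mulmx0,mul0mx,mulmx1,mul1mx,mulmxN,mulNmx,addr0,add0r,oppr0,opprK).
    rewrite !(mul_scalar_mx, mul_mx_scalar, =^~scalemxAl, =^~scalemxAr, scalerA) cc.
    rewrite /block_mx !opp_row_mx !opp_col_mx !oppr0 !add_col_mx !add_row_mx !addr0.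
    by rewrite !(mulmxDr, mulmxDl, mulmxN, mulNmx, scalerDr, scalerN).
  have PQ : forall i j, 0 <= (P1 + Q) i j.
    by move=> i j; rewrite mxE; have := QP i j; rewrite ler_norml; lra.
  have PNQ : forall i j, 0 <= (P1 - Q) i j.
    by move=> i j; rewrite mxE [(- Q) i j]mxE; have := QP i j; rewrite ler_norml; lra.
  have h0 : 0 <= 2%:R^-1 :> R by rewrite invr_ge0 ler0n.
  have J0 := @revId_ge0 R k.
  have P20 : forall i j, 0 <= P2 i j by move=> i j; rewrite !mxE.
  have P30 : forall i j, 0 <= P3 i j by move=> i j; rewrite !mxE.
  have P40 : forall i j, 0 <= P4 i j by move=> i j; rewrite !mxE.
  apply: nonneg_col_mx; apply: nonneg_row_mx.
  + by apply: nonneg_col_mx; apply: nonneg_row_mx => //; apply: nonneg_scalemx.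
  + by apply: nonneg_col_mx; apply: nonneg_scalemx => //; apply: nonneg_mulmx.
  + by apply: nonneg_row_mx; apply: nonneg_scalemx => //; apply: nonneg_mulmx.
  + by apply: nonneg_scalemx => //; do 2![apply: nonneg_mulmx => //].
- by rewrite char_poly_conj // char_poly_block_diag.
Qed.

(** * Perron vectors and bordering *)

(** The eigenvector equation is recorded for [P^T] as well: this makes the bordered matrix normal
    again. *)
Definition perron (R : numDomainType) (k : nat) (P : 'M[R]_k) (u : 'cV[R]_k) (al : R) : Prop :=
  [/\ normal_real_mx P, nonneg_mx P, (forall i j, 0 <= u i j), u^T *m u = 1%:M
    & P *m u = al *: u /\ P^T *m u = al *: u].

(* Right multiplication by [[I, r u], [0, X - al]] clears the upper right block of the
   characteristic matrix, because X I - P acts on u as the scalar X - al. *)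
Lemma char_poly_bordered (R : idomainType) (k : nat) (P : 'M[R]_k) (u : 'cV[R]_k) (al be r : R) :
  P *m u = al *: u -> u^T *m u = 1%:M ->
  char_poly (block_mx P (r *: u) (r *: u^T) be%:M) * ('X - al%:P) =
  char_poly P * (('X - al%:P) * ('X - be%:P) - (r ^+ 2)%:P).
Proof.
move=> Pu uu.
pose f m n (A : 'M[R]_(m, n)) := map_mx polyC A.
have fuu : (f 1%N k u^T) *m f k 1%N u = 1%:M.
  by rewrite /f -map_mxM uu map_mx1.
have fPu : f k k P *m f k 1%N u = al%:P *: f k 1%N u.
  by rewrite /f -map_mxM Pu map_mxZ.
rewrite {1}/char_poly /char_poly_mx map_block_mx scalar_mx_block.
rewrite opp_block_mx add_block_mx !add0r -/(f k k P) !map_mxZ /= -/(f _ _ u) -/(f _ _ u^T).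
rewrite map_scalar_mx.
set M := block_mx _ _ _ _.
pose T : 'M[{poly R}]_(k + 1) := block_mx 1%:M (r%:P *: f k 1%N u) 0 ('X - al%:P)%:M.
have dT : \det T = 'X - al%:P by rewrite /T det_ublock det1 mul1r det_scalar expr1.
rewrite -[X in _ * X = _]dT -det_mulmx.
have -> : M *m T = block_mx ('X%:M - f k k P) 0 (- (r%:P *: f 1%N k u^T))
            ((('X - al%:P) * ('X - be%:P) - (r ^+ 2)%:P)%:M).
  rewrite /M /T mulmx_block !mulmx1 !mulmx0 !addr0; congr block_mx.
    rewrite mul_mx_scalar -scalemxAr mulmxBl fPu mul_scalar_mx.
    by apply/matrixP=> i j; rewrite !mxE; ring.
  rewrite mulNmx -scalemxAr -scalemxAl fuu mul_mx_scalar.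
  by apply/matrixP=> i j; rewrite !ord1 !mxE eqxx; ring.
by rewrite det_lblock det_scalar expr1.
Qed.

(** The border [p * q] is the square root of (la - be)(la - al), chosen so that (X - al)(X - be) -
    (pq)^2 = (X - la)(X - mu). The new Perron vector is (p u, q)/t, of norm 1 because p^2 + q^2 = la
    - mu = t^2. The last clause carries the factor X - al on the left to avoid a division; it is
    cancelled later. *)
Lemma glue (R : rcfType) (k : nat) (P : 'M[R]_k) (u : 'cV[R]_k) (al be la mu : R) :
  perron P u al -> al + be = la + mu -> al <= la -> be <= la -> mu < la -> 0 <= be ->
  exists (P' : 'M[R]_(k + 1)) (u' : 'cV[R]_(k + 1)),
    [/\ perron P' u' la, ulsubmx P' = P, (forall i j, 0 <= ursubmx P' i j),
        (forall i j, 0 <= dlsubmx P' i j) /\ drsubmx P' = be%:M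
      & char_poly P' * ('X - al%:P) = char_poly P * (('X - la%:P) * ('X - mu%:P))].
Proof.
move=> [nP P0 u0 uu [Pu PTu]] tr alla bela mula be0.
pose p := Num.sqrt (la - be); pose q := Num.sqrt (la - al).
have pp : p ^+ 2 = la - be by rewrite sqr_sqrtr // subr_ge0.
have qq : q ^+ 2 = la - al by rewrite sqr_sqrtr // subr_ge0.
have p0 : 0 <= p by rewrite sqrtr_ge0.
have q0 : 0 <= q by rewrite sqrtr_ge0.
have s0 : 0 < la - mu by rewrite subr_gt0.
pose t := Num.sqrt (la - mu).
have t0 : 0 < t by rewrite sqrtr_gt0.
have tt : t ^+ 2 = la - mu by rewrite sqr_sqrtr // ltW.
have w0 i j : 0 <= ((p * q) *: u) i j by rewrite mxE !mulr_ge0.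
pose P' := block_mx P ((p * q) *: u) ((p * q) *: u^T) be%:M.
pose u' := col_mx ((p / t) *: u) (q / t)%:M.
have P'T : P'^T = block_mx P^T ((p * q) *: u) ((p * q) *: u^T) be%:M.
  by rewrite /P' tr_block_mx tr_scalar_mx !linearZ /= trmxK.
have uTP : u^T *m P = al *: u^T by rewrite -[P]trmxK -trmx_mul PTu linearZ.
have uTPT : u^T *m P^T = al *: u^T by rewrite -trmx_mul Pu linearZ.
have tN0 : t != 0 by rewrite gt_eqF.
have P'u' M : M *m u = al *: u ->
    block_mx M ((p * q) *: u) ((p * q) *: u^T) be%:M *m u' = la *: u'.
  move=> Mu; rewrite /u' mul_block_col scale_col_mx; congr col_mx.
    rewrite -scalemxAr Mu mul_mx_scalar !scalerA -scalerDl; congr (_ *: _).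
    have -> : la = q ^+ 2 + al by rewrite qq; ring.
    by field.
  rewrite -scalemxAr -scalemxAl uu -scalar_mxM !scale_scalar_mx -raddfD; congr (_%:M).
  have -> : la = p ^+ 2 + be by rewrite pp; ring.
  by field.
exists P', u'; split; last 1 first.
- rewrite /P' char_poly_bordered //; congr (_ * _).
  have -> : (p * q) ^+ 2 = (la - be) * (la - al) by rewrite exprMn pp qq.
  have -> : mu = al + be - la by rewrite tr; ring.
  by rewrite !(polyCM, polyCD, polyCN); ring.
- split.
  + rewrite /normal_real_mx P'T /P' !mulmx_block -!scalemxAr -!scalemxAl nP.
    rewrite Pu PTu uTP uTPT !mul_scalar_mx !mul_mx_scalar.
    by [].
  + by apply: nonneg_col_mx; apply: nonneg_row_mx => // i j; rewrite !mxE ?mulrn_wge0 ?mulr_ge0.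
  + apply: nonneg_col_mx => i j; first by rewrite mxE mulr_ge0 ?divr_ge0 // ltW.
    by rewrite mxE mulrn_wge0 // divr_ge0 // ltW.
  + have uT c : (c *: u)^T = c *: u^T by rewrite linearZ.
    rewrite /u' tr_col_mx mul_row_col tr_scalar_mx uT.
    rewrite -scalemxAr -scalemxAl uu -scalar_mxM !scale_scalar_mx -raddfD; congr (_%:M) => /=.
    have e : p ^+ 2 + q ^+ 2 = t ^+ 2 by rewrite pp qq tt; move: tr; lra.
    by transitivity ((p ^+ 2 + q ^+ 2) / t ^+ 2); [field | rewrite e divff // expf_neq0].
  + by rewrite P'T; split; apply: P'u'.
- by rewrite block_mxKul.
- by rewrite block_mxKur.
- by rewrite block_mxKdl block_mxKdr; split => // i j; rewrite !mxE !mulr_ge0.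
Qed.


(** * Roots of x^r = c, grouped into real roots and conjugate pairs *)

Lemma uniq_nth_roots (C : numClosedFieldType) (r : nat) (c : C) :
  (0 < r)%N -> c != 0 ->
  exists rs : seq C, [/\ uniq rs, size rs = r & forall x, (x \in rs) = (x ^+ r == c)].
Proof.
move=> r0 c0; have [rs Drs] := closed_field_poly_normal ('X^r - c%:P : {poly C}).
have sp : size ('X^r - c%:P : {poly C}) = r.+1 by rewrite size_XnsubC.
have lc : lead_coef ('X^r - c%:P : {poly C}) = 1.
  by rewrite lead_coefXnsubC.
rewrite lc scale1r in Drs; exists rs.
have mem x : (x \in rs) = (x ^+ r == c).
  by rewrite -root_prod_XsubC -Drs rootE !hornerE subr_eq0.
split => //; last by move: sp; rewrite Drs size_prod_XsubC => -[].
(* The roots are distinct because the derivative r X^(r-1) vanishes at none of them: 0 is not a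
   root, as [c] is nonzero. *)
rewrite -separable_prod_XsubC -Drs unlock derivB derivXn derivC subr0.
apply: Pdiv.ClosedField.root_coprimep => x.
rewrite rootE !hornerE subr_eq0 => /eqP xr.
have x0 : x != 0 by apply: contraNneq c0 => x0; rewrite -xr x0 expr0n gtn_eqF.
by rewrite hornerMn hornerXn -mulr_natl mulf_neq0 ?expf_neq0 // pnatr_eq0 -lt0n.
Qed.

(** Since [c] is real, conjugation permutes the roots and exchanges the two open half-planes. The
    layout (real, upper, conjugates) is that of the eigenvalue lists below, so zipping assigns
    conjugate eigenvalues to conjugate roots. *)
Lemma conj_root_pairs (R : rcfType) (r : nat) (c : R[i]) (rl : seq R[i]) :
  (0 < r)%N -> c != 0 -> (c^*)%C = c -> uniq rl ->
  (forall x, (x \in rl) = (x ^+ r == c) && (complex.Im x == 0)) ->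
  exists ups : seq R[i], let xs := rl ++ ups ++ map conjc ups in
    [/\ uniq xs, size xs = r & forall x, x \in xs -> x ^+ r = c].
Proof.
move=> r0 c0 cc url mrl.
have [rs [urs srs mrs]] := uniq_nth_roots r0 c0.
exists [seq x <- rs | 0 < complex.Im x]; set ups := filter _ _ => xs.
have mc : map conjc ups =i [seq x <- rs | complex.Im x < 0].
  move=> x; rewrite -[x]conjcK mem_map; last exact: can_inj (@conjcK R).
  have e : ((x^*)%C ^+ r == c) = (x ^+ r == c).
    by rewrite -{1}cc -rmorphXn /= (inj_eq (can_inj (@conjcK R))).
  rewrite !mem_filter !mrs conjcK e; congr (_ && _).
  by case: x {e} => a b /=; rewrite oppr_gt0.
have Im_mem x : x \in ups -> 0 < complex.Im x by rewrite mem_filter => /andP[].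
have Im_mem' x : x \in map conjc ups -> complex.Im x < 0 by rewrite mc mem_filter => /andP[].
have uxs : uniq xs.
  rewrite cat_uniq url cat_uniq filter_uniq // map_inj_uniq ?filter_uniq //=; last exact: can_inj (@conjcK R).
  rewrite andbT; apply/andP; split; apply/hasPn => x.
    rewrite mem_cat => /orP[/Im_mem|/Im_mem'] h; rewrite mrl negb_and; apply/orP; right.
      by rewrite gt_eqF.
    by rewrite lt_eqF.
  by move=> /Im_mem' h; apply/negP => /Im_mem; rewrite ltNge (ltW h).
have mxs x : x \in xs = (x \in rs).
  rewrite !mem_cat mc !mem_filter mrl -mrs.
  by case: (x \in rs); rewrite ?andbF //= !andbT; case: ltrgtP.
split=> // [|x]; last by rewrite mxs mrs => /eqP.
by rewrite -srs; apply/perm_size/uniq_perm.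
Qed.

Lemma real_root_unity (R : realDomainType) (r : nat) (y : R) : (0 < r)%N ->
  (y ^+ r == 1) = (y == 1) || (y == -1) && ~~ odd r.
Proof.
move=> r0; apply/idP/idP => [/eqP e|].
  have : `|y| == 1 by rewrite -(pexpr_eq1 r0) // -normrX e normr1.
  rewrite eqr_norml ler01 andbT => /orP[->//|/eqP ye]; rewrite ye eqxx.
  by move: e; rewrite ye -signr_odd; case: odd; rewrite ?orbT //= expr1 => ->; rewrite eqxx.
case/orP=> [/eqP->|/andP[/eqP-> ev]]; first by rewrite expr1n.
by rewrite -signr_odd (negPf ev).
Qed.

(** * Real matrices diagonalised by Fourier vectors *)

(** Each pair consists of a node x and its eigenvalue; the sum is the (i, j) entry of the
    unnormalised V D V^* where the columns of V are the vectors (x^i). *)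
Definition fourier_sum (R : rcfType) (zs : seq (R[i] * R[i])) (i j : nat) : R[i] :=
  \sum_(p <- zs) p.2 * (p.1 ^+ i * (p.1^*)%C ^+ j).

(** Taking [complex.Re] gives a real matrix by construction; nothing is lost when the sums are
    real. *)
Definition fourier_mx (R : rcfType) (r : nat) (xs ss : seq R[i]) : 'M[R]_r :=
  \matrix_(i, j) (r%:R^-1 * complex.Re (fourier_sum (zip xs ss) i j)).

Lemma ReD (R : rcfType) (x y : R[i]) : complex.Re (x + y) = complex.Re x + complex.Re y.
Proof. by case: x y => ? ? []. Qed.

Lemma ImD (R : rcfType) (x y : R[i]) : complex.Im (x + y) = complex.Im x + complex.Im y.
Proof. by case: x y => ? ? []. Qed.

Lemma Im0P (R : rcfType) (x : R[i]) : complex.Im x = 0 <-> (x^*)%C = x.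
Proof.
case: x => a b /=; split=> [->|[/eqP]]; first by rewrite oppr0.
by rewrite eq_sym -addr_eq0 -mulr2n mulrn_eq0 => /eqP.
Qed.

(** The nonnegative number x x^* has r-th power c c^* = 1, hence equals 1. *)
Lemma root_unimodular (R : rcfType) (r : nat) (x c : R[i]) :
  (0 < r)%N -> c * (c^*)%C = 1 -> x ^+ r = c -> x * (x^*)%C = 1.
Proof.
move=> r0 cc xr; apply/eqP; rewrite -(pexpr_eq1 r0) ?mulcJ_ge0 //.
by rewrite exprMn -rmorphXn /= xr cc.
Qed.

Lemma fourier_sum_cat (R : rcfType) (z1 z2 : seq (R[i] * R[i])) (i j : nat) :
  fourier_sum (z1 ++ z2) i j = fourier_sum z1 i j + fourier_sum z2 i j.
Proof. by rewrite /fourier_sum big_cat. Qed.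

Lemma fourier_sum_conj (R : rcfType) (xs ss : seq R[i]) (i j : nat) :
  fourier_sum (zip (map conjc xs) (map conjc ss)) i j = ((fourier_sum (zip xs ss) i j)^*)%C.
Proof.
rewrite /fourier_sum.
elim: xs ss => [|x xs IH] [|s ss] /=; rewrite ?big_nil ?conjc0 //.
by rewrite !big_cons IH rmorphD !rmorphM !rmorphXn /= conjcK.
Qed.

(** Terms with real node and eigenvalue are real, and the remaining ones cancel their imaginary
    parts in conjugate pairs. *)
Lemma fourier_sum_real (R : rcfType) (rl sl ups zs : seq R[i]) (i j : nat) :
  size rl = size sl -> size ups = size zs ->
  (forall x, x \in rl -> complex.Im x = 0) -> (forall x, x \in sl -> complex.Im x = 0) ->
  complex.Im (fourier_sum (zip (rl ++ ups ++ map conjc ups) (sl ++ zs ++ map conjc zs)) i j) = 0.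
Proof.
move=> e1 e2 hr hs; rewrite !zip_cat // !fourier_sum_cat fourier_sum_conj.
rewrite !ImD [X in X + _](_ : _ = 0); last first.
  rewrite /fourier_sum; elim: rl sl hr hs {e1} => [|x rl IH] [|s sl] hr hs /=; rewrite ?big_nil //.
  rewrite big_cons ImD IH ?addr0 => [|y yr|y yr]; last 2 first.
  - by apply: hr; rewrite inE yr orbT.
  - by apply: hs; rewrite inE yr orbT.
  have xJ : (x^*)%C = x by apply/Im0P/hr/mem_head.
  have sJ : (s^*)%C = s by apply/Im0P/hs/mem_head.
  by apply/Im0P; rewrite !rmorphM !rmorphXn /= !xJ sJ.
by rewrite add0r; case: (fourier_sum _ _ _) => a b /=; rewrite subrr.
Qed.

Lemma fourier_sum_le (R : rcfType) (xs ss : seq R[i]) (i j : nat) :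
  (forall x, x \in xs -> x * (x^*)%C = 1) ->
  `|complex.Re (fourier_sum (zip xs ss) i j)| <= \sum_(s <- ss) complex.Re `|s|.
Proof.
move=> hx.
have N0 (zs : seq R[i]) : 0 <= \sum_(s <- zs) complex.Re `|s|.
  by apply: sumr_ge0 => z _; rewrite normc_def sqrtr_ge0.
rewrite /fourier_sum; elim: ss xs hx => [|s ss IH] [|x xs] hx /=.
- by rewrite !big_nil normr0.
- by rewrite !big_nil normr0.
- by rewrite [X in complex.Re X]big_nil normr0; exact: N0.
rewrite !big_cons ReD; apply: le_trans (ler_normD _ _) _; apply: lerD; last first.
  by apply: IH => y yx; apply: hx; rewrite inE yx orbT.
have nx : `|x| = 1.
  by apply/eqP; rewrite -(@pexpr_eq1 _ _ 2) // sqr_normc hx ?mem_head.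
have := normc_ge_Re (s * (x ^+ i * (x^*)%C ^+ j)).
have -> : `|s * (x ^+ i * (x^*)%C ^+ j)| = `|s|.
  by rewrite !normrM !normrX normcJ nx !expr1n !mulr1.
by rewrite (normc_def s) lecR => h; apply: le_trans h _; case: (s).
Qed.

(** Over [R[i]] the matrix is [F *m diag_mx d *m G], where [G] is both the adjoint and the inverse
    of [F]. Normality reduces to the commutation of diagonal matrices, and a first node 1 makes the
    constant vector an eigenvector. *)
Lemma fourier_mxP (R : rcfType) (r : nat) (c : R[i]) (xs ss : seq R[i]) :
  (0 < r)%N -> c * (c^*)%C = 1 -> uniq xs -> size xs = r -> size ss = r ->
  (forall x, x \in xs -> x ^+ r = c) ->
  (forall i j, complex.Im (fourier_sum (zip xs ss) i j) = 0) ->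
  let P := fourier_mx r xs ss in
  [/\ normal_real_mx P,
      map_poly (real_complex R) (char_poly P) = \prod_(s <- ss) ('X - s%:P)
    & forall s, nth 0 xs 0 = 1 -> nth 0 ss 0 = s%:C%C ->
        forall i, \sum_j P i j = s /\ \sum_j P j i = s].
Proof.
move=> r0 cc uxs sx sss xr im P.
have rN0 : r%:R != 0 :> R[i] by rewrite pnatr_eq0 -lt0n.
have [c0 c0c0 c0J] : exists2 c0 : R[i], c0 * c0 = r%:R^-1 & (c0^*)%C = c0.
  exists ((Num.sqrt r%:R)^-1)%:C%C; last exact: conjc_real.
  by rewrite -rmorphM -invfM -expr2 sqr_sqrtr ?ler0n // fmorphV rmorph_nat.
pose x (k : 'I_r) := nth 0 xs k.
pose F : 'M[R[i]]_r := \matrix_(i, k) (x k ^+ i * c0).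
pose G : 'M[R[i]]_r := \matrix_(k, i) ((x k ^+ i * c0)^*)%C.
pose d : 'rV[R[i]]_r := \row_k nth 0 ss k.
pose d' : 'rV[R[i]]_r := \row_k ((nth 0 ss k)^*)%C.
have xrk k : x k ^+ r = c by apply: xr; rewrite mem_nth // sx.
have xx k : x k * (x k)^*%C = 1 by apply: root_unimodular (xrk k).
have GF : G *m F = 1%:M.
  apply/matrixP=> k l; rewrite !mxE.
  pose t := (x k)^*%C * x l.
  have -> : \sum_i G k i * F i l = (\sum_(i < r) t ^+ i) * r%:R^-1.
    rewrite mulr_suml; apply: eq_bigr => i _.
    by rewrite !mxE rmorphM rmorphXn /= c0J exprMn -c0c0; ring.
  have [kl|kl] := eqVneq k l.
    have -> : t = 1 by rewrite /t kl mulrC.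
    under eq_bigr do rewrite expr1n.
    by rewrite sumr_const card_ord divff // eqxx.
  have t1 : t != 1.
    apply: contra kl => /eqP tE; rewrite -(inj_eq val_inj) -(nth_uniq 0 _ _ uxs) ?sx ?ltn_ord //.
    by rewrite -/(x k) -/(x l) -[x l]mul1r -(xx k) -mulrA -/t tE mulr1.
  (* Both nodes are r-th roots of [c], so t^r = c^* c = 1 and the geometric sum vanishes for
     distinct nodes. *)
  have : (t - 1) * \sum_(i < r) t ^+ i = 0.
    by rewrite -subrX1 exprMn -rmorphXn /= !xrk mulrC cc subrr.
  by move/eqP; rewrite mulf_eq0 subr_eq0 (negPf t1) => /eqP ->; rewrite mul0r.
have FG : F *m G = 1%:M by exact: mulmx1C.
pose PC := map_mx (real_complex R) P.
have PCE : PC = F *m diag_mx d *m G.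
  apply/matrixP=> i j; rewrite mul_mx_diag !mxE.
  have -> : ((r%:R^-1 * complex.Re (fourier_sum (zip xs ss) i j))%:C)%C =
      r%:R^-1 * fourier_sum (zip xs ss) i j.
    rewrite rmorphM fmorphV rmorph_nat.
    by congr (_ * _); case: (fourier_sum _ _ _) (im i j) => u v /= ->.
  rewrite /fourier_sum (big_nth (0, 0)) size_zip sx sss minnn big_mkord mulr_sumr.
  apply: eq_bigr => k _; rewrite !mxE nth_zip ?sx ?sss //= -c0c0.
  rewrite rmorphM rmorphXn /= c0J -/(x k).
  have ac (u v w : R[i]) : c0 * c0 * (u * (v * w)) = v * c0 * u * (w * c0) by ring.
  exact: ac.
(* [PC] is real, so its transpose is its adjoint, diagonalised by the same [F] with conjugate
   eigenvalues. *)
have PCTE : PC^T = F *m diag_mx d' *m G.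
  apply/matrixP=> i j; rewrite mxE.
  have -> : PC j i = ((PC j i)^*)%C by rewrite mxE conjc_real.
  have FJ l k : ((F l k)^*)%C = G k l by rewrite !mxE.
  have GJ l k : ((G k l)^*)%C = F l k by rewrite !mxE conjcK.
  rewrite PCE !mul_mx_diag [_ j i]mxE [RHS]mxE rmorph_sum; apply: eq_bigr => k _.
  rewrite [_ j k]mxE [_ i k]mxE [d 0 k]mxE [d' 0 k]mxE !rmorphM /= FJ GJ; ring.
have mxI : injective (@map_mx _ _ (real_complex R) r r).
  by apply: map_mx_inj.
split.
- apply: mxI; rewrite !map_mxM -map_trmx -/PC PCTE PCE.
  have dd (v w : 'rV[R[i]]_r) : F *m diag_mx v *m G *m (F *m diag_mx w *m G) =
      F *m (diag_mx v *m diag_mx w) *m G.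
    by rewrite !mulmxA -(mulmxA _ G F) GF mulmx1.
  by rewrite !dd diag_mxC.
- rewrite map_char_poly -/PC PCE char_poly_conj //.
  rewrite char_poly_trig ?diag_mx_is_trig // (big_nth 0) sss big_mkord.
  by apply: eq_bigr => k _; rewrite !mxE eqxx.
- move=> s x0 s0 i.
  have c00 : c0 != 0.
    by apply: contra_eqN c0c0 => /eqP->; rewrite mul0r eq_sym invr_eq0.
  pose k0 := Ordinal r0.
  (* Column [k0] of [F] is constant, so reading [M F = F diag v] in that column yields the row sums
     of [M]. *)
  have key (M : 'M[R]_r) (v : 'rV[R[i]]_r) :
      map_mx (real_complex R) M = F *m diag_mx v *m G -> v 0 k0 = (s%:C)%C -> \sum_j M i j = s.
    move=> ME v0; apply: (@complexI R); rewrite rmorph_sum.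
    have : (map_mx (real_complex R) M *m F) i k0 = (F *m diag_mx v) i k0.
      by rewrite ME -mulmxA GF mulmx1.
    have F0 j : F j k0 = c0 by rewrite mxE /x /= x0 expr1n mul1r.
    rewrite mul_mx_diag [LHS]mxE [RHS]mxE F0 v0.
    under eq_bigr do rewrite F0 mxE.
    by rewrite -mulr_suml => e; apply: (mulIf c00); rewrite e mulrC.
  have PTE : map_mx (real_complex R) P^T = F *m diag_mx d' *m G by rewrite -map_trmx.
  split; first by apply: key PCE _; rewrite mxE /= s0.
  rewrite -(key _ _ PTE); last by rewrite mxE /= s0 conjc_real.
  by apply: eq_bigr => j _; rewrite [RHS]mxE.
Qed.

(** * The case of a single negative eigenvalue *)

Lemma mem_real_roots1 (R : rcfType) (r : nat) (x : R[i]) : (0 < r)%N ->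
  (x ^+ r == 1) && (complex.Im x == 0) = (x == 1) || (x == -1) && ~~ odd r.
Proof.
move=> r0; case: x => a b; case: (eqVneq b 0) => [->|b0] /=.
  rewrite !complexr0 ?eqxx ?andbT -rmorphXn -(rmorph1 (real_complex R)) -rmorphN.
  by rewrite !(inj_eq (@complexI R)) real_root_unity.
by rewrite andbF !eq_complex /= oppr0 (negPf b0) !andbF.
Qed.

Lemma mem_real_rootsN1 (R : rcfType) (r : nat) (x : R[i]) : ~~ odd r ->
  (x ^+ r == -1) && (complex.Im x == 0) = false.
Proof.
move=> ev; case: x => a b; case: (eqVneq b 0) => [->|b0] /=; last by rewrite andbF.
rewrite !complexr0 ?eqxx ?andbT -rmorphXn -(rmorph1 (real_complex R)) -rmorphN.
rewrite (inj_eq (@complexI R)) gt_eqF // (lt_le_trans (ltrN10 R)) //.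
by rewrite exprn_even_ge0.
Qed.

(* The spectrum is recorded without la, since the gluing steps only alter the Perron root. *)
Definition dilation (R : rcfType) (k : nat) (la : R) (s : seq R[i]) : Prop :=
  exists (P Q : 'M[R]_k) (u : 'cV[R]_k),
    [/\ perron P u la, normal_real_mx Q, (forall i j, `|Q i j| <= P i j)
      & map_poly (real_complex R) (char_poly P * char_poly Q) =
        \prod_(c <- (la%:C)%C :: s) ('X - c%:P)].

(** [sl1], [z1] go to [P] and [sl2], [z2] to [Q]. Up to the factor 1/r, an entry of [P] is at least
    [la] minus the moduli of its other eigenvalues, and an entry of [Q] has absolute value at most
    the sum of its moduli; the last hypothesis compares the two. *)
Lemma dilation_fourier (R : rcfType) (r : nat) (la : R) (c : R[i])
    (rl1 sl1 z1 rl2 sl2 z2 : seq R[i]) :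
  (0 < r)%N -> c * (c^*)%C = 1 -> (c^*)%C = c ->
  uniq (1 :: rl1) ->
  (forall x, (x \in 1 :: rl1) = (x ^+ r == 1) && (complex.Im x == 0)) ->
  uniq rl2 -> (forall x, (x \in rl2) = (x ^+ r == c) && (complex.Im x == 0)) ->
  size rl1 = size sl1 -> size rl2 = size sl2 ->
  r = (1 + size sl1 + (size z1 + size z1))%N -> r = (size sl2 + (size z2 + size z2))%N ->
  (forall s, s \in sl1 -> complex.Im s = 0) -> (forall s, s \in sl2 -> complex.Im s = 0) ->
  \sum_(s <- sl1 ++ z1 ++ z1) complex.Re `|s| + \sum_(s <- sl2 ++ z2 ++ z2) complex.Re `|s| <= la ->
  dilation r la (sl1 ++ z1 ++ map conjc z1 ++ sl2 ++ z2 ++ map conjc z2).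
Proof.
move=> r0 cc cJ u1 m1 u2 m2 e1 e2 er1 er2 h1 h2 bnd.
have c0 : c != 0 by apply: contra_eqN cc => /eqP->; rewrite mul0r eq_sym oner_eq0.
have [ups1 [uxs1 sxs1 rxs1]] := conj_root_pairs r0 (oner_neq0 _) (conjc1 R) u1 m1.
have [ups2 [uxs2 sxs2 rxs2]] := conj_root_pairs r0 c0 cJ u2 m2.
set xs1 := _ ++ _ in uxs1 sxs1 rxs1; set xs2 := _ ++ _ in uxs2 sxs2 rxs2.
have su1 : size ups1 = size z1.
  by move: sxs1; rewrite /xs1 !size_cat size_map /= e1; move: er1; lia.
have su2 : size ups2 = size z2.
  by move: sxs2; rewrite /xs2 !size_cat size_map /= e2; move: er2; lia.
pose ss1 := ((la%:C)%C :: sl1) ++ z1 ++ map conjc z1.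
pose ss2 := sl2 ++ z2 ++ map conjc z2.
have im1 i j : complex.Im (fourier_sum (zip xs1 ss1) i j) = 0.
  apply: fourier_sum_real => //=; first by rewrite e1.
    by move=> x; rewrite m1 => /andP[_ /eqP].
  by move=> s; rewrite inE => /orP[/eqP->//|/h1].
have im2 i j : complex.Im (fourier_sum (zip xs2 ss2) i j) = 0.
  by apply: fourier_sum_real => // x xr; move: (m2 x); rewrite xr => /esym/andP[_ /eqP].
have cc1 : 1 * ((1 : R[i])^*)%C = 1 by rewrite conjc1 mulr1.
have sss1 : size ss1 = r by rewrite /ss1 !size_cat size_map /= er1; lia.
have sss2 : size ss2 = r by rewrite /ss2 !size_cat size_map /= er2.
have [nP chP rowP] := fourier_mxP r0 cc1 uxs1 sxs1 sss1 rxs1 im1.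
have [nQ chQ _] := fourier_mxP r0 cc uxs2 sxs2 sss2 rxs2 im2.
set P := fourier_mx r xs1 ss1 in nP chP rowP.
set Q := fourier_mx r xs2 ss2 in nQ chQ.
have {}rowP := rowP la erefl erefl.
have sumJ (l1 l2 : seq R[i]) : \sum_(s <- l1 ++ l2 ++ map conjc l2) complex.Re `|s| =
    \sum_(s <- l1 ++ l2 ++ l2) complex.Re `|s|.
  by rewrite !big_cat big_map; do 2!congr (_ + _); apply: eq_bigr => s _; rewrite normcJ.
have ri : 0 <= (r%:R : R)^-1 by rewrite invr_ge0 ler0n.
have QP i j : `|Q i j| <= P i j.
  rewrite !mxE normrM (ger0_norm ri) ler_wpM2l //.
  apply: le_trans (fourier_sum_le _ _ _ _) _ => [x xxs|].
    by apply: root_unimodular (rxs2 _ xxs).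
  have -> : zip xs1 ss1 = (1, (la%:C)%C) :: zip (behead xs1) (behead ss1) by [].
  have t1 : (la%:C)%C * (1 ^+ i * ((1 : R[i])^*)%C ^+ j) = (la%:C)%C.
    by rewrite conjc1 !expr1n !mulr1.
  rewrite /fourier_sum big_cons ReD [X in complex.Re X + _]t1 -/(fourier_sum _ i j).
  have : `|complex.Re (fourier_sum (zip (behead xs1) (behead ss1)) i j)| <=
      \sum_(s <- behead ss1) complex.Re `|s|.
    apply: fourier_sum_le => x xxs; apply: root_unimodular (rxs1 _ _) => //.
    exact: mem_behead.
  rewrite ler_norml => /andP[+ _]; move: bnd; rewrite -!sumJ; rewrite /=; lra.
(* All row and column sums of [P] equal [la], so the normalised constant vector is its Perron
   vector. *)
exists P, Q, (const_mx (Num.sqrt r%:R)^-1); split => //.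
- split=> //.
  + by move=> i j; apply: le_trans (QP i j); rewrite normr_ge0.
  + by move=> i j; rewrite mxE invr_ge0 sqrtr_ge0.
  + apply/matrixP=> i j; rewrite !ord1 !mxE eqxx; under eq_bigr do rewrite !mxE.
    rewrite sumr_const card_ord -invfM -expr2 sqr_sqrtr ?ler0n // -[_ *+ r]mulr_natr mulVf //.
    by rewrite pnatr_eq0 -lt0n.
  + split; apply/matrixP=> i j; rewrite [LHS]mxE [RHS]mxE [const_mx _ _ _]mxE.
      by rewrite -(rowP i).1 mulr_suml; apply: eq_bigr => l _; rewrite [const_mx _ _ _]mxE.
    by rewrite -(rowP i).2 mulr_suml; apply: eq_bigr => l _; rewrite [const_mx _ _ _]mxE [P^T _ _]mxE.
- by rewrite rmorphM /= chP chQ /ss1 /ss2 -big_cat /= -!catA.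
Qed.

Lemma dilation_base (R : rcfType) (la mu : R) (zs : seq R[i]) :
  mu < 0 -> 0 <= la + mu - 2 * \sum_(z <- zs) complex.Re `|z| ->
  dilation (size zs + 1) la ((mu%:C)%C :: zs ++ map conjc zs).
Proof.
move=> mu0 bnd.
have Nmu : complex.Re `|(mu%:C)%C| = - mu by rewrite /= expr0n addr0 sqrtr_sqr ltr0_norm.
set h := (size zs)./2.
have sz := odd_double_half (size zs); rewrite -/h in sz.
have E (s1 s2 : seq R[i]) : \sum_(z <- s1 ++ s2 ++ s2) complex.Re `|z| =
   \sum_(z <- s1) complex.Re `|z| + 2 * \sum_(z <- s2) complex.Re `|z|.
  by rewrite !big_cat /=; ring.
have permE (s1 s2 : seq R[i]) k : dilation k la s1 -> perm_eq s1 s2 -> dilation k la s2.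
  move=> [P [Q [u [? ? ? ch]]]] s12; exists P, Q, u; split => //.
  by rewrite ch; apply: perm_big; rewrite perm_cons.
have bnd' : 2 * \sum_(z <- take h zs) complex.Re `|z| + 2 * \sum_(z <- drop h zs) complex.Re `|z| <= la + mu.
  by move: bnd; rewrite -{1}(cat_take_drop h zs) big_cat /=; lra.
have hle : (h <= size zs)%N by lia.
have r0 : (0 < size zs + 1)%N by rewrite addn1.
have perm0 : perm_eq (take h zs ++ map conjc (take h zs) ++ drop h zs ++ map conjc (drop h zs)) (zs ++ map conjc zs).
  have G (s1 s2 : seq R[i]) : perm_eq (s1 ++ map conjc s1 ++ s2 ++ map conjc s2) ((s1 ++ s2) ++ map conjc (s1 ++ s2)).
    by rewrite map_cat -!catA perm_cat2l perm_catCA.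
  by have := G (take h zs) (drop h zs); rewrite cat_take_drop.
have mu_im s : s \in [:: (mu%:C)%C] -> complex.Im s = 0 by rewrite inE => /eqP->.
case: (boolP (odd (size zs))) sz => [od|ev] sz.
- have r_even : ~~ odd (size zs + 1) by rewrite addn1 /= od.
  (* Here [size zs] is 2h + 1 and r = 2h + 2: [P] takes [la] at 1, [mu] at -1 and h pairs, while [Q]
     takes the other h + 1 pairs. *)
  apply: permE (dilation_fourier (c := -1) (rl1 := [:: -1]) (sl1 := [:: (mu%:C)%C]) (z1 := take h zs)
     (rl2 := [::]) (sl2 := [::]) (z2 := drop h zs) _ _ _ _ _ _ _ _ _ _ _ _ _ _) _ => //.
  + by rewrite rmorphN rmorph1 mulrNN mulr1.
  + by rewrite rmorphN rmorph1.
  + by rewrite /= inE andbT -addr_eq0 -mulr2n pnatr_eq0.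
  + by move=> x; rewrite !inE (mem_real_roots1 _ r0) r_even andbT.
  + by move=> x; rewrite mem_real_rootsN1.
  + rewrite /= size_takel //; lia.
  + rewrite /= size_drop; lia.
  + by rewrite !E big_nil big_seq1 Nmu; lra.
  + by rewrite /= perm_cons.
- have r_odd : odd (size zs + 1) by rewrite addn1 /= ev.
  (* Here [size zs] is 2h and r = 2h + 1: [P] takes [la] and h pairs, while [Q] takes [mu] at the
     node 1 and the other h pairs. *)
  apply: permE (dilation_fourier (c := 1) (rl1 := [::]) (sl1 := [::]) (z1 := take h zs)
     (rl2 := [:: 1]) (sl2 := [:: (mu%:C)%C]) (z2 := drop h zs) _ _ _ _ _ _ _ _ _ _ _ _ _ _) _ => //.
  + by rewrite conjc1 mulr1.
  + exact: conjc1.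
  + by move=> x; rewrite !inE (mem_real_roots1 _ r0) r_odd andbF orbF.
  + by move=> x; rewrite !inE (mem_real_roots1 _ r0) r_odd andbF orbF.
  + rewrite /= size_takel //; lia.
  + rewrite /= size_drop; lia.
  + by rewrite !E big_nil big_seq1 Nmu; lra.
  + by rewrite /= -[_ :: drop _ _ ++ _]cat1s catA perm_catCA -catA perm_cons.
Qed.

(** * Adding further negative eigenvalues *)

Lemma dilation_step (R : rcfType) (k : nat) (la x y : R) (s : seq R[i]) :
  x < 0 -> y < 0 -> 0 <= la + x + y ->
  dilation k (la + x + y) s -> dilation (k + 1) la ((x%:C)%C :: (y%:C)%C :: s).
Proof.
move=> x0 y0 al0 [P [Q [u [pP nQ QP ch]]]].
(* Bordering with [be = - y] trades the root la + x + y for [la] and [x]. The new corner of [Q] is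
   [y], whose absolute value is exactly the new corner of [P']. *)
have [|||||P' [u' [pP' ulP urP [dlP drP] chP']]] := @glue _ _ _ _ _ (- y) la x pP; try lra.
exists P', (block_mx Q 0 0 y%:M), u'; split => //.
- rewrite /normal_real_mx tr_block_mx !trmx0 tr_scalar_mx !mulmx_block.
  by rewrite !(mulmx0, mul0mx, addr0, add0r) nQ.
- have P'E : P' = block_mx P (ursubmx P') (dlsubmx P') (- y)%:M by rewrite -drP -ulP submxK.
  move=> i j; rewrite P'E /block_mx !mxE; case: (split i) => i'; rewrite !mxE.
    by case: (split j) => j'; rewrite ?mxE ?normr0 //; have := urP i' j'; rewrite !mxE.
  case: (split j) => j'; rewrite !mxE ?normr0; first by have := dlP i' j'; rewrite !mxE.
  by rewrite !ord1 eqxx !mulr1n ltr0_norm.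
- rewrite char_poly_block_diag.
  have chy : char_poly (y%:M : 'M[R]_1) = 'X - y%:P.
    by rewrite char_poly_trig ?scalar_mx_is_trig // big_ord1 mxE eqxx.
  have XA : 'X - ((la + x + y)%:C)%C%:P != 0 by rewrite polyXsubC_eq0.
  apply: (mulfI XA).
  have mX (a : R) : map_poly (real_complex R) ('X - a%:P) = 'X - ((a%:C)%C)%:P.
    by rewrite rmorphB /= map_polyX map_polyC.
  move: ch (congr1 (map_poly (real_complex R)) chP').
  rewrite chy !rmorphM /= !mX !big_cons => e1 e2.
  by rewrite mulrCA mulrA e2 mulrACA e1; ring.
Qed.

(** Induction on [t], peeling off two negative eigenvalues and lowering the Perron root by their
    moduli; the left side of the bound is unchanged. *)
Lemma dilation_odd (R : rcfType) (t : nat) (la : R) (L : seq R) (zs : seq R[i]) :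
  size L = (t + t + 1)%N -> (forall x, x \in L -> x < 0) ->
  0 <= la + \sum_(x <- L) x - 2 * \sum_(z <- zs) complex.Re `|z| ->
  dilation (size zs + 1 + t) la (map (real_complex R) L ++ zs ++ map conjc zs).
Proof.
elim: t la L => [|t IH] la L.
  by case: L => [|x []] //= _ neg; rewrite big_seq1 addn0; apply: dilation_base; rewrite neg ?mem_head.
case: L => [|x [|y L]] /=; [lia|lia|] => sL neg; rewrite !big_cons => bnd.
have xn : x < 0 by rewrite neg ?mem_head.
have yn : y < 0 by rewrite neg // !inE eqxx orbT.
have negL z : z \in L -> z < 0 by move=> zL; rewrite neg // !inE zL !orbT.
have SL : \sum_(z <- L) z <= 0.
  by rewrite big_seq sumr_le0 // => z /negL/ltW.
have SZ : 0 <= \sum_(z <- zs) complex.Re `|z|.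
  by apply: sumr_ge0 => z _; rewrite normc_def sqrtr_ge0.
rewrite addnS -addn1; apply: dilation_step => //; first by lra.
by apply: IH => //; [lia | lra].
Qed.

(** * Passage from the pair to the centrosymmetric matrix *)

Lemma realize_even (R : rcfType) (k : nat) (la : R) (s : seq R[i]) :
  dilation k la s ->
  exists A : 'M[R]_(k + 0 + k), [/\ normal_real_mx A, centrosymmetric A, nonneg_mx A
    & char_poly (map_mx (real_complex R) A) = \prod_(c <- (la%:C)%C :: s) ('X - c%:P)].
Proof.
move=> [P [Q [u [[nP P0 _ _ _] nQ QP ch]]]].
(* Padding by empty blocks gives [P] the size [k + 0] with [P] itself as upper left block. *)
have [|||||A [nA cA A0 chA]] := @assemble R k 0 (block_mx P 0 0 0) Q.
- by [].
- rewrite /normal_real_mx tr_block_mx !trmx0 !mulmx_block.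
  by rewrite !(mulmx0, mul0mx, addr0, add0r) nP.
- by [].
- apply: nonneg_col_mx; apply: nonneg_row_mx => // i j; rewrite ?mxE //.
- by rewrite block_mxKul.
exists A; split=> //; rewrite -map_char_poly chA char_poly_block_diag.
by rewrite [char_poly 0]det_mx00 mulr1.
Qed.

(** Bordering [P] with [be = 0] replaces la + x by [la] and [x]; the added index becomes the central
    one, and domination of [Q] only concerns the old block. *)
Lemma realize_odd (R : rcfType) (k : nat) (la x : R) (s : seq R[i]) :
  x < 0 -> 0 <= la + x -> dilation k (la + x) s ->
  exists A : 'M[R]_(k + 1 + k), [/\ normal_real_mx A, centrosymmetric A, nonneg_mx A
    & char_poly (map_mx (real_complex R) A) =
      \prod_(c <- (la%:C)%C :: (x%:C)%C :: s) ('X - c%:P)].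
Proof.
move=> x0 al0 [P [Q [u [pP nQ QP ch]]]].
have [|||||P' [u' [[nP' P'0 _ _ _] ulP _ _ chP']]] := @glue _ _ _ _ _ 0 la x pP; try lra.
have [|||||A [nA cA A0 chA]] := @assemble R k 1 P' Q => //; first by rewrite ulP.
exists A; split => //; rewrite -map_char_poly chA.
have XA : 'X - ((la + x)%:C)%C%:P != 0 by rewrite polyXsubC_eq0.
apply: (mulfI XA).
have mX (a : R) : map_poly (real_complex R) ('X - a%:P) = 'X - ((a%:C)%C)%:P.
  by rewrite rmorphB /= map_polyX map_polyC.
move: ch (congr1 (map_poly (real_complex R)) chP').
rewrite !rmorphM /= !mX !big_cons => e1 e2.
by rewrite mulrCA mulrA e2 mulrAC e1; ring.

Qed.

Theorem theorem3p15 (R : realType) (n m : nat)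
    (lam : 'I_n.+1 -> R) (a b : 'I_m -> R) :
  (3 <= n)%N -> (1 <= m)%N ->
  0 <= lam ord0 ->
  (forall i : 'I_n.+1, (0 < val i)%N -> lam i < 0) ->
  (forall i j : 'I_n.+1, (0 < val i)%N -> (val i <= val j)%N -> lam j <= lam i) ->
  (forall j, 0 < b j) ->
  0 <= \sum_(i < n.+1) lam i
        - 2 * \sum_(j < m) Num.sqrt (a j ^+ 2 + b j ^+ 2) ->
  exists A : 'M[R]_((n + 2 * m).+1),
    [/\ normal_real_mx A, centrosymmetric A, nonneg_mx A &
        real_mx_eigenvalues A
          ([seq (lam i)%:C%C | i <- enum 'I_n.+1]
           ++ [seq (a j +i* b j)%C | j <- enum 'I_m]
           ++ [seq (a j -i* b j)%C | j <- enum 'I_m])].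
Proof.
move=> n3 m1 _ neg _ b0 bnd.
pose zs := [seq (a j +i* b j)%C | j <- enum 'I_m].
pose L := [seq lam (lift ord0 i) | i <- enum 'I_n].
have lamE : [seq (lam i)%:C%C | i <- enum 'I_n.+1] = (lam ord0)%:C%C :: map (real_complex R) L.
  by rewrite enum_ordSl /= -!map_comp.
have sL : size L = n by rewrite size_map size_enum_ord.
have szs : size zs = m by rewrite size_map size_enum_ord.
have zsJ : [seq (a j -i* b j)%C | j <- enum 'I_m] = map conjc zs.
  by rewrite -[RHS]map_comp; apply: eq_map.
have Lneg x : x \in L -> x < 0 by move=> /mapP[i _ ->]; apply: neg.
have bndL : 0 <= lam ord0 + \sum_(x <- L) x - 2 * \sum_(z <- zs) complex.Re `|z|.
  have -> : \sum_(x <- L) x = \sum_(i < n) lam (lift ord0 i) by rewrite big_map big_enum.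
  by move: bnd; rewrite big_ord_recl; congr (0 <= _ - 2 * _); rewrite big_map big_enum.
have SZ : 0 <= \sum_(z <- zs) complex.Re `|z|.
  by apply: sumr_ge0 => z _; rewrite normc_def sqrtr_ge0.
(* The sizes [k + e + k] and [(n + 2 * m).+1] are equal only by arithmetic, so the size is
   generalised to [N] and substituted. *)
suff [N NE [A [nA cA A0 chA]]] : exists2 N, N = (n + 2 * m).+1 & exists A : 'M[R]_N,
    [/\ normal_real_mx A, centrosymmetric A, nonneg_mx A
      & char_poly (map_mx (real_complex R) A) =
        \prod_(c <- (lam ord0)%:C%C :: map (real_complex R) L ++ zs ++ map conjc zs) ('X - c%:P)].
  subst N; exists A; split => //; rewrite lamE zsJ; exact: chA.
move: L sL Lneg bndL {lamE}; set la := lam ord0; move=> L sL Lneg bndL.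
have nE := odd_double_half n; case: (boolP (odd n)) nE => [od|ev] nE.
- exists (size zs + 1 + n./2 + 0 + (size zs + 1 + n./2))%N; first by rewrite szs; lia.
  by apply/realize_even/dilation_odd => //; rewrite sL; lia.
(* For even [n] the first negative eigenvalue is reserved for the centre; the other n - 1 = 2t + 1
   are handled with t = n/2 - 1. *)
- case: L sL Lneg bndL => [|x L] sL Lneg bndL; first by move: n3; rewrite -sL.
  move: bndL; rewrite [X in _ + X - _]big_cons => bndL /=.
  have xneg : x < 0 by rewrite Lneg ?mem_head.
  have Lneg' y : y \in L -> y < 0 by move=> yL; rewrite Lneg // inE yL orbT.
  have SL : \sum_(z <- L) z <= 0 by rewrite big_seq sumr_le0 // => z /Lneg'/ltW.
  exists (size zs + 1 + (n./2).-1 + 1 + (size zs + 1 + (n./2).-1))%N; first by rewrite szs; lia.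
  apply: realize_odd => //; first by lra.
  by apply: dilation_odd => //; [move: sL => /=; lia|lra].
Qed.
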